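(* $$\sum_{k=0}^{\infty}\frac{\binom{2k}{k}^4\binom{4k}{2k}}{2^{16k}}\Big\{2(120k^2+34k+3)H_{4k}-16k-1\Big\}=0.$$
   Context: For a nonnegative integer $n$, $H_n=\sum_{j=1}^{n}\frac{1}{j}$ denotes the classical harmonic number, with $H_0=0$. *)

(* Defs.v *)
From Stdlib Require Import Reals.
From Coquelicot Require Import Coquelicot.
Open Scope R_scope.

(* [sum_n_m a 1 0] is the empty sum, so [harmonic 0 = 0]. *)
Definition harmonic (n : nat) : R := sum_n_m (fun j : nat => 1 / INR j) 1 n.

(* Coquelicot's complex numbers shadow the name [C] of the Stdlib binomial
   coefficient. *)
Definition binom (n k : nat) : R := Binomial.C n k.

(* Main.v *)
Require Import Defs.
From Stdlib Require Import Reals Factorial Lra Lia.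
From Coquelicot Require Import Coquelicot.
Open Scope R_scope.

(** The series is the derivative at [x = 0], term by term, of a
    one-parameter family deforming Guillera's series
    [sum binom(2n,n)^4 binom(4n,2n) (120 n^2 + 34 n + 3) / 2^(16n)].
    With rising factorials [(a)_m], put

      W_x(n,k) = (1/2+x)_{n+k} (1/2)_{n+k} (1/2-x)_k (1/2)_k
                 (1/2)_n^2 (1/2-x)_n (1/2+x)_n (1/2+x)_{2n}
               / ((1-x)_{n+k} (n+k)! (1+x)_{2n+k+1} (2n+k+1)! (2n)!),
      G_x(n,k) = 32 W_x(n,k) n (1+4n+4k) (2n+k+1) (2n+k+1+x).

    There is a polynomial [Q_x(n,k)] for which [F_x = W_x Q_x] satisfies the
    Wilf-Zeilberger relation
    [F_x(n,k+1) - F_x(n,k) = G_x(n+1,k) - G_x(n,k)]. It comes from the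
    well-poised series of Dougall's 5F4 theorem with parameters
    [a = c = e = 1/2], [b = 1/2+x], [d = 1/2-x], accelerated along the
    parameter shift (a,b,c,d,e) -> (a+2,b+1,c+1,d,e).

    Every rising factorial in [W_x] is nonzero at [x = 0], so the
    [x]-derivatives [dF] and [dG] of [F_x] and [G_x] at [0] are explicit:
    [W_0] times a combination of harmonic numbers and polynomials. They satisfy
    the same relation ([dF_dG_WZ]), which is checked directly as an identity of
    rational functions in [n], [k] and the value of the logarithmic derivative
    [log_deriv] of [W_x]; no differentiation is performed. In the column [k = 0] the
    harmonic numbers in [log_deriv] collapse to [2 H_{4n} - 1/(2n+1)], and
    [dF n 0] is the summand of the theorem ([dF_k0]).

    Since [dG] vanishes for [n = 0] and as [n] grows, the sum of [dF n k] over [n]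
    does not depend on [k]. It tends to [0] as [k] grows, because
    [|dF n k| <= M 2^(-n) / (k+1)] ([dF_bound]). Therefore it is [0]. Comparing
    the column [0] with the column [N] in the partial sum up to [N] turns this
    into the quantitative bound [sum_dF_0_bound], with no interchange of
    limits. *)

(** * The differentiated Wilf-Zeilberger pair *)

(** This is [(1/2)_m / m!]. *)
Definition central (m : nat) : R := binom (2 * m) m / 4 ^ m.

(** This is the sum of [1 / (j + 1/2)] for [j < m], the logarithmic derivative of
    [(1/2 + x)_m] at [x = 0]. *)
Definition half_harmonic (m : nat) : R := 2 * harmonic (2 * m) - harmonic m.

Definition inv_multinomial (n k : nat) : R :=
  INR (fact k) * INR (fact n) ^ 2 / INR (fact (2 * n + k + 1)).

(** [W_0(n,k)]. Splitting off the reciprocal multinomial leaves factors in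
    [[0, 1]], so that all the decay sits in [inv_multinomial]. *)
Definition weight (n k : nat) : R :=
  central (n + k) ^ 2 * central k ^ 2 * central n ^ 4 * central (2 * n)
  * inv_multinomial n k ^ 2.

(** The logarithmic derivative of [W_x(n,k)] at [x = 0]; the contributions of
    [(1/2-x)_n] and [(1/2+x)_n] cancel. *)
Definition log_deriv (n k : nat) : R :=
  half_harmonic (n + k) - half_harmonic k + half_harmonic (2 * n)
  + harmonic (n + k) - harmonic (2 * n + k + 1).

(** The value and the [x]-derivative at [x = 0] of the polynomial [Q_x]. They
    were obtained by solving the Wilf-Zeilberger relation with [G_x]
    prescribed: it is linear in the coefficients of [Q_x]. *)
Definition wz_poly (n k : R) : R :=
  3 + 24 * k + 68 * k ^ 2 + 80 * k ^ 3 + 32 * k ^ 4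
  + n * (46 + 288 * k + 488 * k ^ 2 + 256 * k ^ 3)
  + n ^ 2 * (268 + 992 * k + 768 * k ^ 2)
  + n ^ 3 * (616 + 1024 * k) + 480 * n ^ 4.

Definition wz_poly_dx (n k : R) : R :=
  2 + 20 * k + 48 * k ^ 2 + 32 * k ^ 3
  + n * (20 + 168 * k + 176 * k ^ 2)
  + n ^ 2 * (120 + 320 * k) + 176 * n ^ 3.

Definition dF (n k : nat) : R :=
  weight n k * (wz_poly (INR n) (INR k) * log_deriv n k + wz_poly_dx (INR n) (INR k)).

Definition dG (n k : nat) : R :=
  weight n k * (32 * INR n * (1 + 4 * INR n + 4 * INR k)
    * ((2 * INR n + INR k + 1) ^ 2 * log_deriv n k + (2 * INR n + INR k + 1))).

(** * Recurrences *)

Lemma harmonic_0 : harmonic 0 = 0.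
Proof. unfold harmonic. now rewrite sum_n_m_zero by lia. Qed.

Lemma harmonic_S (n : nat) : harmonic (S n) = harmonic n + 1 / (INR n + 1).
Proof.
  unfold harmonic. rewrite sum_n_Sm by lia. now rewrite S_INR.
Qed.

Lemma half_harmonic_0 : half_harmonic 0 = 0.
Proof. unfold half_harmonic. simpl. rewrite harmonic_0. ring. Qed.

Lemma half_harmonic_S (m : nat) :
  half_harmonic (S m) = half_harmonic m + 2 / (2 * INR m + 1).
Proof.
  unfold half_harmonic. replace (2 * S m)%nat with (S (S (2 * m))) by lia.
  rewrite !harmonic_S, S_INR, mult_INR. simpl (INR 2).
  assert (H := pos_INR m). field. lra.
Qed.

Lemma harmonic_increment (m d : nat) :
  0 <= harmonic (m + d) - harmonic m <= INR d.
Proof.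
  induction d as [|d IH].
  - rewrite Nat.add_0_r. simpl. lra.
  - replace (m + S d)%nat with (S (m + d)) by lia.
    rewrite harmonic_S, S_INR.
    assert (H := pos_INR (m + d)).
    assert (0 <= 1 / (INR (m + d) + 1) <= 1).
    { split; [apply Rle_div_r | apply Rle_div_l]; lra. }
    lra.
Qed.

Lemma half_harmonic_increment (m d : nat) :
  0 <= half_harmonic (m + d) - half_harmonic m <= 2 * INR d.
Proof.
  induction d as [|d IH].
  - rewrite Nat.add_0_r. simpl. lra.
  - replace (m + S d)%nat with (S (m + d)) by lia.
    rewrite half_harmonic_S, S_INR.
    assert (H := pos_INR (m + d)).
    assert (0 <= 2 / (2 * INR (m + d) + 1) <= 2).
    { split; [apply Rle_div_r | apply Rle_div_l]; lra. }
    lra.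
Qed.

Lemma central_0 : central 0 = 1.
Proof. unfold central, binom, Binomial.C. simpl. field. Qed.

Lemma central_S (m : nat) :
  central (S m) = central m * ((2 * INR m + 1) / (2 * INR m + 2)).
Proof.
  unfold central, binom, Binomial.C.
  replace (2 * S m - S m)%nat with (S m) by lia.
  replace (2 * m - m)%nat with m by lia.
  replace (2 * S m)%nat with (S (S (2 * m))) by lia.
  rewrite !fact_simpl, !mult_INR, !S_INR, mult_INR.
  change (INR 2) with 2. simpl pow.
  assert (H := pos_INR m). assert (Hf := INR_fact_neq_0 m).
  assert (H4 : 4 ^ m <> 0) by (apply pow_nonzero; lra).
  field. repeat split; (assumption || lra).
Qed.

Lemma central_bounds (m : nat) : 0 <= central m <= 1.
Proof.
  induction m as [|m IH].
  - rewrite central_0. lra.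
  - rewrite central_S. assert (H := pos_INR m).
    assert (0 <= (2 * INR m + 1) / (2 * INR m + 2) <= 1).
    { split; [apply Rle_div_r | apply Rle_div_l]; lra. }
    nra.
Qed.

Lemma inv_multinomial_Sk (n k : nat) :
  inv_multinomial n (S k)
  = inv_multinomial n k * ((INR k + 1) / (2 * INR n + INR k + 2)).
Proof.
  unfold inv_multinomial.
  replace (2 * n + S k + 1)%nat with (S (2 * n + k + 1)) by lia.
  rewrite !fact_simpl, !mult_INR, !S_INR, !plus_INR, mult_INR.
  change (INR 2) with 2. change (INR 1) with 1.
  assert (H := pos_INR n). assert (H' := pos_INR k).
  assert (Hf := INR_fact_neq_0 (2 * n + k + 1)).
  field. repeat split; (assumption || lra).
Qed.

Lemma inv_multinomial_Sn (n k : nat) :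
  inv_multinomial (S n) k
  = inv_multinomial n k
    * ((INR n + 1) ^ 2
       / ((2 * INR n + INR k + 2) * (2 * INR n + INR k + 3))).
Proof.
  unfold inv_multinomial.
  replace (2 * S n + k + 1)%nat with (S (S (2 * n + k + 1))) by lia.
  rewrite !fact_simpl, !mult_INR, !S_INR, !plus_INR, mult_INR.
  change (INR 2) with 2. change (INR 1) with 1.
  assert (H := pos_INR n). assert (H' := pos_INR k).
  assert (Hf := INR_fact_neq_0 (2 * n + k + 1)).
  field. repeat split; (assumption || lra).
Qed.

Lemma inv_multinomial_0 (k : nat) : inv_multinomial 0 k = 1 / (INR k + 1).
Proof.
  unfold inv_multinomial. replace (2 * 0 + k + 1)%nat with (S k) by lia.
  rewrite fact_simpl, mult_INR, S_INR. change (INR (fact 0)) with 1.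
  assert (H := pos_INR k). assert (Hf := INR_fact_neq_0 k).
  field. repeat split; (assumption || lra).
Qed.

Lemma inv_multinomial_ge0 (n k : nat) : 0 <= inv_multinomial n k.
Proof.
  unfold inv_multinomial.
  assert (H1 := INR_fact_lt_0 k). assert (H2 := INR_fact_lt_0 n).
  assert (H3 := INR_fact_lt_0 (2 * n + k + 1)).
  apply Rle_div_r; [lra | nra].
Qed.

Lemma weight_Sk (n k : nat) :
  weight n (S k)
  = weight n k
    * ((2 * INR n + 2 * INR k + 1) / (2 * INR n + 2 * INR k + 2)
       * ((2 * INR k + 1) / (2 * INR k + 2))
       * ((INR k + 1) / (2 * INR n + INR k + 2))) ^ 2.
Proof.
  unfold weight. rewrite <- plus_n_Sm, !central_S, inv_multinomial_Sk, plus_INR.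
  rewrite !Rmult_plus_distr_l. ring.
Qed.

Lemma weight_Sn (n k : nat) :
  weight (S n) k
  = weight n k
    * ((2 * INR n + 2 * INR k + 1) / (2 * INR n + 2 * INR k + 2)
       * ((2 * INR n + 1) / (2 * INR n + 2)) ^ 2
       * ((INR n + 1) ^ 2
         / ((2 * INR n + INR k + 2) * (2 * INR n + INR k + 3)))) ^ 2
    * ((4 * INR n + 1) / (4 * INR n + 2) * ((4 * INR n + 3) / (4 * INR n + 4))).
Proof.
  unfold weight. replace (2 * S n)%nat with (S (S (2 * n))) by lia.
  rewrite Nat.add_succ_l, !central_S, inv_multinomial_Sn, S_INR, plus_INR, mult_INR.
  change (INR 2) with 2.
  replace (2 * (2 * INR n + 1) + 1) with (4 * INR n + 3) by ring.
  replace (2 * (2 * INR n + 1) + 2) with (4 * INR n + 4) by ring.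
  replace (2 * (2 * INR n)) with (4 * INR n) by ring.
  rewrite !Rmult_plus_distr_l. ring.
Qed.

Lemma log_deriv_Sk (n k : nat) :
  log_deriv n (S k)
  = log_deriv n k + 2 / (2 * INR n + 2 * INR k + 1) - 2 / (2 * INR k + 1)
    + 1 / (INR n + INR k + 1) - 1 / (2 * INR n + INR k + 2).
Proof.
  unfold log_deriv. replace (2 * n + S k + 1)%nat with (S (2 * n + k + 1)) by lia.
  rewrite <- plus_n_Sm, !half_harmonic_S, !harmonic_S, !plus_INR, mult_INR.
  change (INR 2) with 2. change (INR 1) with 1.
  replace (2 * INR n + INR k + 1 + 1) with (2 * INR n + INR k + 2) by ring.
  rewrite !Rmult_plus_distr_l. ring.
Qed.

Lemma log_deriv_Sn (n k : nat) :
  log_deriv (S n) k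
  = log_deriv n k + 2 / (2 * INR n + 2 * INR k + 1)
    + 2 / (4 * INR n + 1) + 2 / (4 * INR n + 3)
    + 1 / (INR n + INR k + 1)
    - 1 / (2 * INR n + INR k + 2) - 1 / (2 * INR n + INR k + 3).
Proof.
  unfold log_deriv.
  replace (2 * S n + k + 1)%nat with (S (S (2 * n + k + 1))) by lia.
  replace (2 * S n)%nat with (S (S (2 * n))) by lia.
  rewrite Nat.add_succ_l, !half_harmonic_S, !harmonic_S, !S_INR, !plus_INR, mult_INR.
  change (INR 2) with 2. change (INR 1) with 1.
  replace (2 * INR n + INR k + 1 + 1) with (2 * INR n + INR k + 2) by ring.
  replace (2 * INR n + INR k + 2 + 1) with (2 * INR n + INR k + 3) by ring.
  replace (2 * (2 * INR n + 1) + 1) with (4 * INR n + 3) by ring.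
  replace (2 * (2 * INR n)) with (4 * INR n) by ring.
  rewrite !Rmult_plus_distr_l. ring.
Qed.

(** After division by [weight n k] both sides are affine in [log_deriv n k]. The
    coefficient of [log_deriv n k] is the Wilf-Zeilberger relation at [x = 0];
    the rest is its first-order term in [x]. *)
Lemma dF_dG_WZ (n k : nat) : dF n (S k) - dF n k = dG (S n) k - dG n k.
Proof.
  unfold dF, dG. rewrite weight_Sk, weight_Sn, log_deriv_Sk, log_deriv_Sn, !S_INR.
  unfold wz_poly, wz_poly_dx.
  assert (Hn := pos_INR n). assert (Hk := pos_INR k).
  generalize (weight n k) (log_deriv n k); intros w l.
  revert Hn Hk. generalize (INR n) (INR k). intros x y Hx Hy.
  field.
  repeat split; lra.
Qed.

(** * Sums over a column *)

Lemma dG_0 (k : nat) : dG 0 k = 0.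
Proof. unfold dG. simpl (INR 0). ring. Qed.

(** The relation telescopes in [n], and the lower boundary term [dG 0 k] is
    zero. *)
Lemma sum_dF_step (N k : nat) :
  sum_n (fun n => dF n (S k)) N = sum_n (fun n => dF n k) N + dG (S N) k.
Proof.
  induction N as [|N IH].
  - rewrite !sum_O. assert (H := dF_dG_WZ 0 k). rewrite dG_0 in H. lra.
  - rewrite !sum_Sn, IH. unfold plus; simpl.
    assert (H := dF_dG_WZ (S N) k). lra.
Qed.

(** * Decay of the pair *)

(** Proves [0 <= p] for a polynomial [p] in nonnegative variables whose expansion
    has only positive coefficients. *)
Ltac nonneg_coefficients :=
  ring_simplify;
  repeat (apply Rplus_le_le_0_compat || apply Rmult_le_pos || apply pow_le || lra).

Lemma wz_poly_bounds (n k : R) :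
  0 <= n -> 0 <= k -> 0 <= wz_poly n k <= 480 * (n + k + 1) ^ 4.
Proof.
  intros Hn Hk. unfold wz_poly. split; [|apply Rminus_le_0]; nonneg_coefficients.
Qed.

Lemma wz_poly_dx_bounds (n k : R) :
  0 <= n -> 0 <= k -> 0 <= wz_poly_dx n k <= 480 * (n + k + 1) ^ 3.
Proof.
  intros Hn Hk. unfold wz_poly_dx. split; [|apply Rminus_le_0]; nonneg_coefficients.
Qed.

(** Only increments of length [O(n)] of harmonic sums occur, hence a bound
    uniform in [k]. *)
Lemma log_deriv_bound (n k : nat) : Rabs (log_deriv n k) <= 6 * (INR n + 1).
Proof.
  unfold log_deriv.
  assert (H1 := half_harmonic_increment k n).
  assert (H2 := half_harmonic_increment 0 (2 * n)).
  assert (H3 := harmonic_increment (n + k) (n + 1)).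
  rewrite (Nat.add_comm k n) in H1. rewrite Nat.add_0_l, half_harmonic_0 in H2.
  replace (n + k + (n + 1))%nat with (2 * n + k + 1)%nat in H3 by lia.
  rewrite mult_INR in H2. rewrite plus_INR in H3. simpl (INR 2) in H2. simpl (INR 1) in H3.
  assert (H := pos_INR n). apply Rabs_le. lra.
Qed.

Lemma weight_bounds (n k : nat) : 0 <= weight n k <= inv_multinomial n k ^ 2.
Proof.
  unfold weight.
  assert (H1 := central_bounds (n + k)). assert (H2 := central_bounds k).
  assert (H3 := central_bounds n). assert (H4 := central_bounds (2 * n)).
  assert (Hpow : forall x j, 0 <= x <= 1 -> 0 <= x ^ j <= 1).
  { intros x j Hx. split; [apply pow_le; lra|].
    rewrite <- (pow1 j). apply pow_incr; lra. }
  assert (Hmul : forall x y, 0 <= x <= 1 -> 0 <= y <= 1 -> 0 <= x * y <= 1)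
    by (intros; nra).
  assert (H5 := pow2_ge_0 (inv_multinomial n k)).
  assert (H : 0 <= central (n + k) ^ 2 * central k ^ 2 * central n ^ 4
                   * central (2 * n) <= 1) by (do 3 (apply Hmul; [|now auto]); now auto).
  nra.
Qed.

(** From [n] to [n + 1] the squared reciprocal multinomial shrinks by at least
    [1/16], while the polynomial factors grow by at most [(3/2)^4] and [3/2];
    the product [243/512] of these ratios is less than [1/2]. For [n = 0] the
    left-hand side grows like [k^2], so the induction starts at [n = 1]. *)
Lemma inv_multinomial_decay (n k : nat) :
  inv_multinomial (S n) k ^ 2 * (INR (S n) + INR k + 1) ^ 4 * (INR (S n) + 1)
  <= 4 * (1 / 2) ^ S n / (INR k + 1).
Proof.
  assert (Hk := pos_INR k).
  induction n as [|n IH].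
  - rewrite inv_multinomial_Sn, inv_multinomial_0. simpl (INR _).
    apply Rminus_le_0.
    replace (4 * (1 / 2) ^ 1 / (INR k + 1) - _) with
      (2 * (INR k ^ 3 + 6 * INR k ^ 2 + 11 * INR k + 5)
        / ((INR k + 1) ^ 2 * (INR k + 3) ^ 2)) by (field; lra).
    apply Rle_div_r.
    + apply Rmult_lt_0_compat; apply pow_lt; lra.
    + nonneg_coefficients.
  - rewrite inv_multinomial_Sn. rewrite (S_INR (S n)).
    set (x := INR (S n)) in *. set (y := INR k) in *.
    set (A := inv_multinomial (S n) k) in *.
    assert (Hx : 1 <= x).
    { unfold x. rewrite S_INR. assert (H := pos_INR n). lra. }
    set (r := (x + 1) ^ 2 / ((2 * x + y + 2) * (2 * x + y + 3))).
    assert (Hr : 0 <= r <= 1 / 4).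
    { unfold r. split.
      - apply Rle_div_r; [|rewrite Rmult_0_l; apply pow2_ge_0].
        apply Rmult_lt_0_compat; lra.
      - apply Rle_div_l; [apply Rmult_lt_0_compat; lra|]. nra. }
    assert (Hr2 : 0 <= r ^ 2 <= 1 / 16) by nra.
    assert (Hs : 0 <= (x + 1 + y + 1) ^ 4 <= 81 / 16 * (x + y + 1) ^ 4).
    { split; [apply pow_le; lra|].
      replace (81 / 16 * (x + y + 1) ^ 4) with ((3 / 2 * (x + y + 1)) ^ 4) by field.
      apply pow_incr. lra. }
    assert (Ht : 0 <= (x + 1 + y + 1) ^ 4 * (x + 1 + 1)
                 <= (81 / 16 * (x + y + 1) ^ 4) * (3 / 2 * (x + 1))).
    { split; [apply Rmult_le_pos; lra|]. apply Rmult_le_compat; lra. }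
    assert (HA : 0 <= A ^ 2) by apply pow2_ge_0.
    assert (Hsum : 0 <= (x + y + 1) ^ 4) by (apply pow_le; lra).
    assert (Hprod : 0 <= A ^ 2 * ((x + y + 1) ^ 4 * (x + 1)))
      by (apply Rmult_le_pos; [|apply Rmult_le_pos]; lra).
    apply Rle_trans with
      (A ^ 2 * (1 / 16 * ((81 / 16 * (x + y + 1) ^ 4) * (3 / 2 * (x + 1))))).
    + replace ((A * r) ^ 2 * (x + 1 + y + 1) ^ 4 * (x + 1 + 1))
        with (A ^ 2 * (r ^ 2 * ((x + 1 + y + 1) ^ 4 * (x + 1 + 1)))) by ring.
      apply Rmult_le_compat_l; [assumption|]. apply Rmult_le_compat; lra.
    + replace (4 * (1 / 2) ^ S (S n) / (y + 1))
        with (1 / 2 * (4 * (1 / 2) ^ S n / (y + 1))) by (simpl; field; lra).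
      lra.
Qed.

Lemma dF_factor_bound (n k : nat) :
  Rabs (wz_poly (INR n) (INR k) * log_deriv n k + wz_poly_dx (INR n) (INR k))
  <= 3360 * (INR n + INR k + 1) ^ 4 * (INR n + 1).
Proof.
  assert (Hn := pos_INR n). assert (Hk := pos_INR k).
  assert (H0 := wz_poly_bounds _ _ Hn Hk). assert (H1 := wz_poly_dx_bounds _ _ Hn Hk).
  assert (HL := log_deriv_bound n k).
  eapply Rle_trans; [apply Rabs_triang|].
  rewrite Rabs_mult, (Rabs_pos_eq (wz_poly _ _)), (Rabs_pos_eq (wz_poly_dx _ _)) by lra.
  assert (Rabs (log_deriv n k) * wz_poly (INR n) (INR k)
          <= 6 * (INR n + 1) * (480 * (INR n + INR k + 1) ^ 4))
    by (apply Rmult_le_compat; try lra; apply Rabs_pos).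
  assert (480 * (INR n + INR k + 1) ^ 3
          <= 480 * (INR n + INR k + 1) ^ 4 * (INR n + 1)).
  { apply Rminus_le_0. nonneg_coefficients. }
  lra.
Qed.

Lemma dG_factor_bound (n k : nat) :
  Rabs (32 * INR n * (1 + 4 * INR n + 4 * INR k)
    * ((2 * INR n + INR k + 1) ^ 2 * log_deriv n k + (2 * INR n + INR k + 1)))
  <= 3360 * (INR n + INR k + 1) ^ 4 * (INR n + 1).
Proof.
  assert (HL := log_deriv_bound n k).
  revert HL. generalize (log_deriv n k); intros l.
  assert (Hn := pos_INR n). assert (Hk := pos_INR k). revert Hn Hk.
  generalize (INR n) (INR k); intros x y Hx Hy HL.
  set (s := x + y + 1).
  assert (Hout : 0 <= 32 * x * (1 + 4 * x + 4 * y) <= 128 * s ^ 2).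
  { unfold s. split; [|apply Rminus_le_0]; nonneg_coefficients. }
  assert (Hin : Rabs ((2 * x + y + 1) ^ 2 * l + (2 * x + y + 1))
                <= 26 * s ^ 2 * (x + 1)).
  { eapply Rle_trans; [apply Rabs_triang|].
    rewrite Rabs_mult, (Rabs_pos_eq (_ ^ 2)), (Rabs_pos_eq (_ + 1))
      by (lra || apply pow2_ge_0).
    assert (Rabs l * (2 * x + y + 1) ^ 2 <= 6 * (x + 1) * (2 * s) ^ 2).
    { apply Rmult_le_compat; try assumption; [apply Rabs_pos|apply pow2_ge_0|].
      apply pow_incr. unfold s. lra. }
    assert (2 * x + y + 1 <= 2 * s ^ 2 * (x + 1)).
    { unfold s. apply Rminus_le_0. nonneg_coefficients. }
    lra. }
  rewrite Rabs_mult, (Rabs_pos_eq (32 * _ * _)) by lra.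
  apply Rle_trans with (128 * s ^ 2 * (26 * s ^ 2 * (x + 1))).
  - apply Rmult_le_compat; try lra. apply Rabs_pos.
  - apply Rminus_le_0. unfold s. nonneg_coefficients.
Qed.

Lemma weighted_bound (n k : nat) (f : R) :
  Rabs f <= 3360 * (INR (S n) + INR k + 1) ^ 4 * (INR (S n) + 1) ->
  Rabs (weight (S n) k * f) <= 13440 * (1 / 2) ^ S n / (INR k + 1).
Proof.
  intros Hf. assert (Hw := weight_bounds (S n) k).
  assert (HD := inv_multinomial_decay n k).
  rewrite Rabs_mult, (Rabs_pos_eq (weight _ _)) by lra.
  apply Rle_trans with (inv_multinomial (S n) k ^ 2
    * (3360 * (INR (S n) + INR k + 1) ^ 4 * (INR (S n) + 1))).
  - apply Rmult_le_compat; try lra. apply Rabs_pos.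
  - unfold Rdiv in *. lra.
Qed.

(** In the row [n = 0] the generic estimate fails. There
    [log_deriv 0 k = - 1/(k+1)], and the leading term of [wz_poly_dx] cancels
    against that of [wz_poly / (k+1)]. *)
Lemma dF_0 (k : nat) :
  dF 0 k = - central k ^ 4 * (2 * INR k + 1) / (INR k + 1) ^ 3.
Proof.
  unfold dF, weight, log_deriv, wz_poly, wz_poly_dx.
  replace (2 * 0 + k + 1)%nat with (S k) by lia.
  rewrite inv_multinomial_0, harmonic_S. simpl (2 * 0)%nat.
  rewrite Nat.add_0_l, half_harmonic_0, central_0. simpl (INR 0).
  assert (H := pos_INR k). field. lra.
Qed.

Lemma dF_bound (n k : nat) :
  Rabs (dF n k) <= 13440 * (1 / 2) ^ n / (INR k + 1).
Proof.
  destruct n as [|n]; [|apply weighted_bound, dF_factor_bound].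
  rewrite dF_0. assert (Hk := pos_INR k). assert (Hc := central_bounds k).
  assert (Hc4 : 0 <= central k ^ 4 <= 1).
  { split; [apply pow_le; lra|]. rewrite <- (pow1 4). apply pow_incr; lra. }
  assert (Hq : 0 <= (2 * INR k + 1) / (INR k + 1) ^ 3 <= 13440 / (INR k + 1)).
  { split; [apply Rdiv_le_0_compat; [lra | apply pow_lt; lra]|].
    apply Rminus_le_0.
    replace (13440 / (INR k + 1) - (2 * INR k + 1) / (INR k + 1) ^ 3)
      with ((13440 * (INR k + 1) ^ 2 - (2 * INR k + 1)) / (INR k + 1) ^ 3)
      by (field; lra).
    apply Rdiv_le_0_compat; [nra | apply pow_lt; lra]. }
  replace (- central k ^ 4 * (2 * INR k + 1) / (INR k + 1) ^ 3)
    with (- (central k ^ 4 * ((2 * INR k + 1) / (INR k + 1) ^ 3)))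
    by (field; lra).
  rewrite Rabs_Ropp, Rabs_pos_eq by (apply Rmult_le_pos; lra).
  rewrite pow_O, Rmult_1_r. nra.
Qed.

Lemma dG_bound (n k : nat) :
  Rabs (dG n k) <= 13440 * (1 / 2) ^ n.
Proof.
  assert (Hk := pos_INR k).
  destruct n as [|n]; [rewrite dG_0, Rabs_R0; simpl; lra|].
  eapply Rle_trans; [apply weighted_bound, dG_factor_bound|].
  assert (H : 0 < (1 / 2) ^ S n) by (apply pow_lt; lra).
  apply Rle_div_l; nra.
Qed.

(** * Vanishing of the sum *)

Lemma sum_dF_column_bound (N k : nat) :
  Rabs (sum_n (fun n => dF n k) N) <= 26880 / (INR k + 1).
Proof.
  assert (Hk := pos_INR k).
  enough (H : Rabs (sum_n (fun n => dF n k) N)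
              <= 13440 * (2 - (1 / 2) ^ N) / (INR k + 1)).
  { eapply Rle_trans; [exact H|]. unfold Rdiv. apply Rmult_le_compat_r.
    - left. apply Rinv_0_lt_compat. lra.
    - assert (0 < (1 * / 2) ^ N) by (apply pow_lt; lra). lra. }
  induction N as [|N IH].
  - rewrite sum_O. eapply Rle_trans; [apply dF_bound|]. simpl. right. field. lra.
  - rewrite sum_Sn. eapply Rle_trans; [apply Rabs_triang|].
    assert (H := dF_bound (S N) k).
    replace (13440 * (2 - (1 / 2) ^ S N) / (INR k + 1)) with
      (13440 * (2 - (1 / 2) ^ N) / (INR k + 1) + 13440 * (1 / 2) ^ S N / (INR k + 1))
      by (simpl; field; lra).
    lra.
Qed.

Lemma sum_dF_shift (N K : nat) :
  Rabs (sum_n (fun n => dF n 0) N)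
  <= Rabs (sum_n (fun n => dF n K) N) + INR K * (13440 * (1 / 2) ^ S N).
Proof.
  induction K as [|K IH].
  - simpl INR. lra.
  - rewrite sum_dF_step, S_INR. assert (H := dG_bound (S N) K).
    assert (Htriang : forall s g : R, Rabs s <= Rabs (s + g) + Rabs g).
    { intros s g. replace s with (s + g + - g) at 1 by ring.
      rewrite <- (Rabs_Ropp g). apply Rabs_triang. }
    specialize (Htriang (sum_n (fun n => dF n K) N) (dG (S N) K)). lra.
Qed.

Lemma pow_half_le_inv_square (N : nat) : (1 / 2) ^ S N * (INR N + 1) ^ 2 <= 2.
Proof.
  (* From [N = 3] on, [(N + 2)^2 / (N + 1)^2 <= 2] and induction applies. *)
  assert (Hsmall : forall m, (1 / 2) ^ S (3 + m) * (INR (3 + m) + 1) ^ 2 <= 2).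
  { induction m as [|m IH]; [simpl; lra|].
    replace (3 + S m)%nat with (S (3 + m)) by lia.
    rewrite S_INR. change ((1 / 2) ^ S (S (3 + m))) with (1 / 2 * (1 / 2) ^ S (3 + m)).
    assert (Hp : 0 < (1 / 2) ^ S (3 + m)) by (apply pow_lt; lra).
    assert (Hm : 3 <= INR (3 + m)).
    { rewrite plus_INR. simpl (INR 3). assert (H := pos_INR m). lra. }
    nra. }
  destruct N as [|[|[|N]]]; [simpl; lra..|exact (Hsmall N)].
Qed.

(** Moving from column [0] to column [N] costs [N] boundary terms of size
    [O(2^(-N))], and the column [N] has sum [O(1/N)]. *)
Lemma sum_dF_0_bound (N : nat) :
  Rabs (sum_n (fun n => dF n 0) N) <= 53760 / (INR N + 1).
Proof.
  assert (HN := pos_INR N).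
  eapply Rle_trans; [apply (sum_dF_shift N N)|].
  assert (H1 := sum_dF_column_bound N N). assert (H2 := pow_half_le_inv_square N).
  assert (Hp : 0 < (1 / 2) ^ S N) by (apply pow_lt; lra).
  set (p := (1 / 2) ^ S N) in *.
  assert (INR N * (13440 * p) <= 26880 / (INR N + 1)).
  { apply -> Rle_div_r; [|lra].
    assert (0 < p * (INR N + 1)) by (apply Rmult_lt_0_compat; lra).
    lra. }
  replace (53760 / (INR N + 1)) with (26880 / (INR N + 1) + 26880 / (INR N + 1))
    by (field; lra).
  lra.
Qed.

(** * The column k = 0 *)

Lemma log_deriv_0 (n : nat) :
  log_deriv n 0 = 2 * harmonic (4 * n) - 1 / (2 * INR n + 1).
Proof.
  unfold log_deriv. replace (2 * n + 0 + 1)%nat with (S (2 * n)) by lia.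
  rewrite Nat.add_0_r, half_harmonic_0, harmonic_S, mult_INR. unfold half_harmonic.
  replace (2 * (2 * n))%nat with (4 * n)%nat by lia. change (INR 2) with 2. ring.
Qed.

Lemma weight_0 (n : nat) :
  weight n 0 * (2 * INR n + 1) ^ 2
  = binom (2 * n) n ^ 4 * binom (4 * n) (2 * n) / 2 ^ (16 * n).
Proof.
  unfold weight. rewrite central_0, Nat.add_0_r.
  (* One factor [central n ^ 2] of [central n ^ 6] pairs with
     [inv_multinomial n 0 ^ 2] to give [16 ^ -n]. *)
  assert (Hinv : inv_multinomial n 0 * (2 * INR n + 1) * binom (2 * n) n = 1).
  { unfold inv_multinomial, binom, Binomial.C.
    replace (2 * n + 0 + 1)%nat with (S (2 * n)) by lia.
    replace (2 * n - n)%nat with n by lia.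
    rewrite fact_simpl, mult_INR, S_INR, mult_INR. change (INR (fact 0)) with 1.
    change (INR 2) with 2.
    assert (Hn := pos_INR n). assert (H1 := INR_fact_neq_0 n).
    assert (H2 := INR_fact_neq_0 (2 * n)).
    field. repeat split; (assumption || lra). }
  unfold central. replace (2 * (2 * n))%nat with (4 * n)%nat by lia.
  replace (2 ^ (16 * n)) with ((4 ^ n) ^ 8)
    by (rewrite <- pow_mult; change 4 with (2 * 2); rewrite Rpow_mult_distr,
        <- pow_add; f_equal; lia).
  replace (4 ^ (2 * n)) with ((4 ^ n) ^ 2)
    by (rewrite <- pow_mult; f_equal; lia).
  assert (H4 : 4 ^ n <> 0) by (apply pow_nonzero; lra).
  set (b := binom (2 * n) n) in *. set (A := inv_multinomial n 0) in *.
  set (t := 2 * INR n + 1) in *.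
  transitivity (b ^ 4 * binom (4 * n) (2 * n) / (4 ^ n) ^ 8 * (A * t * b) ^ 2).
  - field. assumption.
  - rewrite Hinv. field. assumption.
Qed.

(** The term [- 1/(2n+1)] of [log_deriv n 0], multiplied by
    [wz_poly n 0 = (2n+1)^2 (120 n^2 + 34 n + 3)], combines with [wz_poly_dx n 0]
    into [(2n+1)^2 (- 16 n - 1)]. *)
Lemma dF_k0 (n : nat) :
  dF n 0
  = binom (2 * n) n ^ 4 * binom (4 * n) (2 * n) / 2 ^ (16 * n)
    * (2 * (120 * INR n ^ 2 + 34 * INR n + 3) * harmonic (4 * n)
       - 16 * INR n - 1).
Proof.
  rewrite <- weight_0. unfold dF. rewrite log_deriv_0. unfold wz_poly, wz_poly_dx.
  simpl (INR 0). assert (H := pos_INR n). field. lra.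
Qed.

Theorem theorem1p8 :
  is_series
    (fun k : nat =>
       binom (2 * k) k ^ 4 * binom (4 * k) (2 * k) / 2 ^ (16 * k)
       * (2 * (120 * INR k ^ 2 + 34 * INR k + 3) * harmonic (4 * k)
          - 16 * INR k - 1))
    0.
Proof.
  apply (is_series_ext (fun n => dF n 0)); [exact dF_k0|].
  change (is_lim_seq (sum_n (fun n => dF n 0)) 0).
  apply is_lim_seq_abs_0.
  apply is_lim_seq_le_le with (fun _ => 0) (fun N => 53760 * / (INR N + 1)).
  - intros N. split; [apply Rabs_pos | apply sum_dF_0_bound].
  - apply is_lim_seq_const.
  - replace (Finite 0) with (Rbar_mult 53760 0) by (simpl; f_equal; ring).
    apply is_lim_seq_scal_l.
    replace (Finite 0) with (Rbar_inv p_infty) by reflexivity.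
    apply is_lim_seq_inv; [|discriminate].
    apply is_lim_seq_ext with (fun N => INR (S N)); [intros N; apply S_INR|].
    apply (is_lim_seq_incr_1 INR), is_lim_seq_INR.
Qed.
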